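(* For every $k\ge1$ there is $c>0$ such that, for every $n>2k$ and every pair of weighted hypergraphs $w,u:[n]^{(k)}\to\mathbb{R}$, $$\mathbb{E}_\pi|\langle w_\pi,u\rangle|\ge cn^k\sum_{i=0}^k n^{-i/2}W_iU_i,$$ where $\pi$ is a uniformly random permutation of $[n]$ and $(W_0,\ldots,W_k)$, $(U_0,\ldots,U_k)$ are the $W$-vectors of $w$ and $u$ respectively.
   Context: $[n]=\{1,\ldots,n\}$; $V^{(k)}$ is the family of $k$-subsets of $V$. A weighted $k$-uniform hypergraph on $V$ is a function $w:V^{(k)}\to\mathbb{R}$; $w(S)=\sum_{e\in S^{(k)}}w(e)$, $\langle w,u\rangle=\sum_{e\in V^{(k)}}w(e)u(e)$, and $w_\pi(e)=w(\pi^{-1}(e))$ for a permutation $\pi$ of $V$. $W$-vector (defined recursively on $k$): for a weighted $k$-uniform hypergraph $w$ on an $n$-set $V$, $W_0=|w(V)|/\binom nk$ (for $k=0$, $w$ is a single real number and $W_0=|w|$). For $k\ge1$ and distinct $x,y\in V$, the difference weighting $w^{xy}:(V\setminus\{x,y\})^{(k-1)}\to\mathbb{R}$ is $w^{xy}(e)=w(e\cup\{x\})-w(e\cup\{y\})$; letting $(W^{xy}_0,\ldots,W^{xy}_{k-1})$ be its $W$-vector, for $1\le i\le k$, $W_i=\frac{1}{n(n-1)}\sum_{(x,y):\,x\ne y}W^{xy}_{i-1}$ (average over ordered pairs of distinct vertices). The $W$-vector is $(W_0,\ldots,W_k)$. *)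

(* Defs.v *)
From HB Require Import structures.
From mathcomp Require Import all_boot all_order all_fingroup all_algebra.
From mathcomp Require Import reals.
Set Implicit Arguments. Unset Strict Implicit. Unset Printing Implicit Defensive.
Import Order.TTheory GRing.Theory Num.Theory.
Local Open Scope ring_scope.

(* A weighted k-uniform hypergraph on a vertex set V : {set T} is represented
   by a function w : {set T} -> R; only its values on k-subsets of V matter. *)

Section Hyper.
Variable R : realType.
Variable T : finType.

Definition wsum (k : nat) (V : {set T}) (w : {set T} -> R) : R :=
  \sum_(e : {set T} | (e \subset V) && (#|e| == k)%N) w e.

Definition hip (k : nat) (V : {set T}) (w u : {set T} -> R) : R :=
  \sum_(e : {set T} | (e \subset V) && (#|e| == k)%N) w e * u e.

Definition W0 (k : nat) (V : {set T}) (w : {set T} -> R) : R :=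
  `|wsum k V w| / ('C(#|V|, k))%:R.

Definition wdiff (w : {set T} -> R) (x y : T) : {set T} -> R :=
  fun e => w (x |: e) - w (y |: e).

Fixpoint Wc (k : nat) : nat -> {set T} -> ({set T} -> R) -> R :=
  fun i V w =>
  match i with
  | 0 => W0 k V w
  | i'.+1 =>
    match k with
    | 0 => 0 (* not used: i <= k *)
    | k'.+1 =>
      ((#|V| * (#|V| - 1))%:R)^-1 *
      \sum_(x in V) \sum_(y in V | y != x) Wc k' i' (V :\ x :\ y) (wdiff w x y)
    end
  end.

End Hyper.

Definition wperm (R : realType) (n : nat) (s : 'S_n) (w : {set 'I_n} -> R)
  : {set 'I_n} -> R := fun e => w (s^-1 @: e)%g.

Definition Eperm (R : realType) (n k : nat) (w u : {set 'I_n} -> R) : R :=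
  (n`!%:R)^-1 * \sum_(s : 'S_n) `|hip k [set: 'I_n] (wperm s w) u|.

(* Main.v *)
Require Import Defs.
From HB Require Import structures.
From mathcomp Require Import all_boot all_order all_fingroup all_algebra.
From mathcomp Require Import reals boolp zify ring lra.
Import Order.TTheory GRing.Theory Num.Theory.
Local Open Scope ring_scope.

(* It suffices to bound the expectation below by each term separately.
   Fix m = n/2 disjoint pairs of vertices.  Swapping each pair independently
   with probability 1/2 turns <w_pi, u> into a polynomial of degree at most k in
   m random signs.  By hypercontractivity its L1 norm is at least a constant
   times its L2 norm, hence, by Bessel and Cauchy-Schwarz, at least a constant
   times C(m,i)^(-1/2) times the sum of the absolute values of its degree i
   coefficients.  The coefficient of a set S of i pairs, averaged over the
   permutations fixing the endpoints of S, is
   2^(-i) D_S w(V') D_S u(V') / C(n-2i, k-i), where D_S is the iterated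
   difference and V' the set of remaining vertices; so by Jensen its expected
   absolute value is at least 2^(-i) C(n-2i, k-i) W_i U_i. *)

(** * Polynomials in random signs: Cauchy-Schwarz and hypercontractivity *)

Section Cube.
Context {R : realType} {X : Type} {P : eqType} (act : P -> X -> X).
Implicit Types (f g : X -> R) (ts : seq P) (x : X).

Definition even_part (p : P) f x : R := (f x + f (act p x)) / 2.
Definition odd_part (p : P) f x : R := (f x - f (act p x)) / 2.

(* Average of [f] over all ways of applying or not applying each map
   [act p], [p] in [ts]. *)
Fixpoint cube ts f : X -> R :=
  if ts is p :: ts' then cube ts' (even_part p f) else f.

(* Degree as a polynomial in independent signs, one per element of [ts]. *)
Fixpoint deg_le (k : nat) ts f : Prop :=
  if ts is p :: ts' then
    deg_le k ts' (even_part p f) /\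
    (if k is k'.+1 then deg_le k' ts' (odd_part p f)
     else forall x, odd_part p f x = 0)
  else True.

Lemma cubeD ts f g x :
  cube ts (fun y => f y + g y) x = cube ts f x + cube ts g x.
Proof.
elim: ts f g => [|p ts IH] f g //=; rewrite -IH; congr (cube ts _ x).
by apply: funext => y; rewrite /even_part; field.
Qed.

Lemma cubeZ ts (a : R) f x : cube ts (fun y => a * f y) x = a * cube ts f x.
Proof.
elim: ts f => [|p ts IH] f //=; rewrite -IH; congr (cube ts _ x).
by apply: funext => y; rewrite /even_part; field.
Qed.

Lemma cube_ge0 ts f x : (forall y, 0 <= f y) -> 0 <= cube ts f x.
Proof.
elim: ts f => [|p ts IH] f f0 //=; apply: IH => y.
by rewrite /even_part divr_ge0 ?addr_ge0.
Qed.

Lemma ler_cube ts f g x : (forall y, f y <= g y) -> cube ts f x <= cube ts g x.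
Proof.
move=> fg; rewrite -subr_ge0.
have -> : cube ts g x - cube ts f x = cube ts (fun y => g y + -1 * f y) x.
  by rewrite cubeD cubeZ mulN1r.
by apply: cube_ge0 => y; rewrite mulN1r subr_ge0.
Qed.

(** Two-term Cauchy-Schwarz: [y ^+ 2 * z ^+ 2 <= (p * b) * (q * a)] gives
    [2 * (y * z) <= p * b + q * a] by AM-GM. It is the induction step of both [cube_cauchy] and
    [level_le]. *)
Lemma sqrrD_le (p a q b y z : R) : 0 <= p -> 0 <= a -> 0 <= q -> 0 <= b ->
  y ^+ 2 <= p * a -> z ^+ 2 <= q * b -> (y + z) ^+ 2 <= (p + q) * (a + b).
Proof.
move=> p0 a0 q0 b0 hy hz.
have h : (2 * (y * z)) ^+ 2 <= (p * b + q * a) ^+ 2.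
  have : y ^+ 2 * z ^+ 2 <= p * a * (q * b) by rewrite ler_pM ?sqr_ge0.
  have := sqr_ge0 (p * b - q * a); nra.
have h' : 2 * (y * z) <= p * b + q * a.
  have pos : 0 <= p * b + q * a by rewrite addr_ge0 ?mulr_ge0.
  by rewrite (le_trans (ler_norm _)) // -ler_sqr ?nnegrE // (real_normK (num_real _)).
nra.
Qed.

Lemma cube_even_part ts p f x :
  cube ts (even_part p f) x =
  2^-1 * (cube ts f x + cube ts (fun y => f (act p y)) x).
Proof.
rewrite -cubeD -cubeZ; congr (cube ts _ x).
by apply: funext => y; rewrite /even_part mulrC.
Qed.

Lemma cube_cauchy ts f g x :
  (cube ts (fun y => f y * g y) x) ^+ 2 <=
  cube ts (fun y => f y ^+ 2) x * cube ts (fun y => g y ^+ 2) x.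
Proof.
elim: ts f g => [|p ts IH] f g /=; first by rewrite exprMn.
rewrite !cube_even_part.
have sq0 (h : X -> R) : 0 <= cube ts (fun y => h y ^+ 2) x.
  by apply: cube_ge0 => y; exact: sqr_ge0.
have := sqrrD_le _ _ _ _ _ _ (sq0 f) (sq0 g)
  (sq0 (fun y => f (act p y))) (sq0 (fun y => g (act p y)))
  (IH f g) (IH (fun y => f (act p y)) (fun y => g (act p y))).
nra.
Qed.

Lemma even_part_sqr p f x :
  even_part p (fun y => f y ^+ 2) x = even_part p f x ^+ 2 + odd_part p f x ^+ 2.
Proof. by rewrite /even_part /odd_part; field. Qed.

Lemma even_part_exp4 p f x : even_part p (fun y => f y ^+ 4) x =
  even_part p f x ^+ 4 + 6 * (even_part p f x ^+ 2 * odd_part p f x ^+ 2)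
  + odd_part p f x ^+ 4.
Proof. by rewrite /even_part /odd_part; field. Qed.

(** Bonami's induction on the number of signs. Splitting off one sign writes [f] as an even part [g]
    plus a sign times an odd part [h] of degree one less. Odd powers of the sign average out,
    leaving the moments of [g ^+ 4], [6 * (g ^+ 2 * h ^+ 2)] and [h ^+ 4]; Cauchy-Schwarz handles
    the mixed one. *)
Lemma hypercontractive k ts f x : deg_le k ts f ->
  cube ts (fun y => f y ^+ 4) x <= 9 ^+ k * cube ts (fun y => f y ^+ 2) x ^+ 2.
Proof.
elim: ts k f => [|p ts IH] k f /=.
  by move=> _; rewrite -exprM ler_peMl ?exprn_even_ge0 // exprn_ege1 // ler1n.
move=> [dg dh].
have -> : even_part p (fun y => f y ^+ 2) =
    (fun y => even_part p f y ^+ 2 + odd_part p f y ^+ 2).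
  by apply: funext => y; rewrite even_part_sqr.
have -> : even_part p (fun y => f y ^+ 4) = (fun y => even_part p f y ^+ 4 +
   6 * (even_part p f y ^+ 2 * odd_part p f y ^+ 2) + odd_part p f y ^+ 4).
  by apply: funext => y; rewrite even_part_exp4.
rewrite !cubeD cubeZ.
have := IH _ _ dg; move: (even_part p f) => g in dg *.
move: (odd_part p f) dh => h dh.
set G := cube ts _ x; set a := cube ts _ x => hG.
set M := cube ts (fun y => g y ^+ 2 * h y ^+ 2) x.
have a0 : 0 <= a by apply: cube_ge0 => y; rewrite exprn_even_ge0.
case: k hG dg dh => [|k] hG _ dh.
  have zero c : cube ts (fun y => c y * 0) x = 0.
    rewrite -[RHS](mul0r (cube ts c x)) -cubeZ; congr (cube ts _ x).
    by apply: funext => y; rewrite mulrC.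
  have h0 : h = (fun=> 0 * 0) by apply: funext => y; rewrite dh mulr0.
  have -> : M = 0.
    rewrite -(zero (fun y => g y ^+ 2)); congr (cube ts _ x).
    by apply: funext => y; rewrite h0 mul0r expr0n.
  have -> : cube ts (fun y => h y ^+ 4) x = 0.
    rewrite -(zero (fun=> 0)); congr (cube ts _ x).
    by apply: funext => y; rewrite h0 mul0r expr0n.
  have -> : cube ts (fun y => h y ^+ 2) x = 0.
    rewrite -(zero (fun=> 0)); congr (cube ts _ x).
    by apply: funext => y; rewrite h0 mul0r expr0n.
  by rewrite mulr0 !addr0.
have := IH _ _ dh.
set H := cube ts _ x; set b := cube ts _ x => hH.
have b0 : 0 <= b by apply: cube_ge0 => y; rewrite exprn_even_ge0.
have G0 : 0 <= G by apply: cube_ge0 => y; rewrite exprn_even_ge0.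
have H0 : 0 <= H by apply: cube_ge0 => y; rewrite exprn_even_ge0.
have CS : M ^+ 2 <= G * H.
  have e4 (c : X -> R) : (fun y => (c y ^+ 2) ^+ 2) = (fun y => c y ^+ 4).
    by apply: funext => y; rewrite -exprM.
  by have := cube_cauchy ts (fun y => g y ^+ 2) (fun y => h y ^+ 2) x; rewrite !e4.
have e0 : 0 <= 9 ^+ k :> R by rewrite exprn_ge0.
(* The constant is the square root of [9 ^+ k.+1 * 9 ^+ k]. Then [6 * M] is at most
   [2 * 9 ^+ k.+1 * (a * b)], exactly the cross term of [9 ^+ k.+1 * (a + b) ^+ 2]. *)
have M1 : M <= 3 * 9 ^+ k * (a * b).
  have ub0 : 0 <= 3 * 9 ^+ k * (a * b) by rewrite !mulr_ge0.
  rewrite (le_trans (ler_norm _)) // -ler_sqr ?nnegrE // (real_normK (num_real _)).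
  apply: (le_trans CS).
  apply: (@le_trans _ _ ((9 ^+ k.+1 * a ^+ 2) * (9 ^+ k * b ^+ 2))).
    by rewrite ler_pM.
  by rewrite exprS le_eqVlt; apply/orP; left; apply/eqP; ring.
have b2 : 0 <= 9 ^+ k * b ^+ 2 by rewrite mulr_ge0 ?sqr_ge0.
move: hG; rewrite exprS => hG.
nra.
Qed.

(** Fourth moment method: a fourth moment comparable to the squared second moment prevents the first
    moment from being small. *)
Lemma cube_norm_ge k ts f x : deg_le k ts f ->
  3 / 4 / 3 ^+ k * Num.sqrt (cube ts (fun y => f y ^+ 2) x)
    <= cube ts (fun y => `|f y|) x.
Proof.
move=> df; have := hypercontractive _ _ _ x df.
have [q0|] := eqVneq (cube ts (fun y => f y ^+ 2) x) 0.
  by move=> _; rewrite q0 sqrtr0 mulr0 cube_ge0.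
set q := cube ts _ x; set F := cube ts _ x => qn0 hF.
have q0 : 0 < q by rewrite lt_def qn0 cube_ge0 // => y; rewrite sqr_ge0.
set d := Num.sqrt q; have d0 : 0 < d by rewrite sqrtr_gt0.
have dq : q = d ^+ 2 by rewrite sqr_sqrtr // ltW.
set e := 3 ^+ k : R; have e0 : 0 < e by rewrite exprn_gt0.
have ee : 9 ^+ k = e ^+ 2 :> R.
  by rewrite /e exprAC; congr (_ ^+ k); ring.
(* [|y| >= y^2 / s - y^4 / (4 s^3)] is integrated with [s = 3^k d] *)
set s := e * d; have s0 : 0 < s by rewrite mulr_gt0.
have pt (y : R) : s^-1 * y ^+ 2 + (- (4 * s ^+ 3)^-1) * y ^+ 4 <= `|y|.
  have -> : y ^+ 4 = `|y| ^+ 4.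
    by rewrite -[4%N]/(2 * 2)%N !exprM real_normK // num_real.
  rewrite -(real_normK (num_real y)).
  move: `|y| (normr_ge0 y) => z z0.
  have [v v0 ->] : exists2 v, 0 <= v & z = s * v.
    exists (z / s); first by rewrite divr_ge0 // ltW.
    by rewrite mulrC divfK // gt_eqF.
  have -> : s^-1 * (s * v) ^+ 2 + - (4 * s ^+ 3)^-1 * (s * v) ^+ 4 =
     s * (v ^+ 2 - v ^+ 4 / 4) by field; rewrite gt_eqF.
  rewrite ler_pM2l //.
  have : 0 <= v * (4 - 4 * v + v ^+ 3).
    rewrite mulr_ge0 //; have [v1|v1] := leP v 1.
      by have := exprn_ge0 3 v0; lra.
    have := sqr_ge0 (v - 3 / 2); nra.
  rewrite -subr_ge0 => h.
  have -> : v - (v ^+ 2 - v ^+ 4 / 4) = v * (4 - 4 * v + v ^+ 3) / 4 by field.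
  lra.
have := ler_cube ts _ _ x (fun y => pt (f y)).
rewrite cubeD !cubeZ -/q -/F; apply: le_trans.
have h : F <= e ^+ 2 * d ^+ 4 by rewrite -ee (le_trans hF) // dq -exprM.
have h2 : (4 * s ^+ 3)^-1 * F <= (4 * s ^+ 3)^-1 * (e ^+ 2 * d ^+ 4).
  by rewrite ler_pM2l // invr_gt0 mulr_gt0 ?exprn_gt0.
(* With [s = e * d] this equals [d / e - d / (4 * e)], whence the factor 3/4. *)
apply: (@le_trans _ _ (s^-1 * d ^+ 2 - (4 * s ^+ 3)^-1 * (e ^+ 2 * d ^+ 4))).
  rewrite le_eqVlt; apply/orP; left; apply/eqP.
  by rewrite /s; field; rewrite !gt_eqF.
by rewrite dq mulNr lerB.
Qed.

(** * Walsh coefficients of a given degree *)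

Fixpoint masks (m i : nat) : seq bitseq :=
  match m, i with
  | 0, 0 => [:: [::]]
  | 0, _ => [::]
  | m'.+1, 0 => map (cons false) (masks m' 0)
  | m'.+1, i'.+1 => map (cons false) (masks m' i) ++ map (cons true) (masks m' i')
  end.

Lemma size_masks m i : size (masks m i) = 'C(m, i).
Proof.
elim: m i => [|m IH] [|i] //=; first by rewrite size_map IH !bin0.
by rewrite size_cat !size_map !IH binS.
Qed.

Lemma masksP m i s : s \in masks m i -> size s = m /\ count id s = i.
Proof.
elim: m i s => [|m IH] [|i] s /=; rewrite ?inE //.
- by move/eqP->.
- by move=> /mapP[s' /IH[<- c] ->] /=; rewrite c.
by rewrite mem_cat => /orP[] /mapP[s' /IH[<- c] ->] /=; rewrite c.
Qed.

(* Fourier-Walsh coefficient of [f] at the subset of [ts] selected by [s]. *)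
Fixpoint walsh (s : bitseq) ts f : X -> R :=
  match s, ts with
  | b :: s', p :: ts' => walsh s' ts' (if b then odd_part p f else even_part p f)
  | _, _ => f
  end.

(** Cauchy-Schwarz over the ['C(size ts, i)] coefficients of degree [i], then Bessel. The induction
    does both at once: [masks] follows Pascal's rule, so the binomials of the even and odd halves
    add up in [sqrrD_le]. *)
Lemma level_le ts i f x :
  (\sum_(s <- masks (size ts) i) `|walsh s ts f x|) ^+ 2 <=
  'C(size ts, i)%:R * cube ts (fun y => f y ^+ 2) x.
Proof.
have sq0 us g : 0 <= cube us (fun y => g y ^+ 2) x.
  by apply: cube_ge0 => y; exact: sqr_ge0.
elim: ts i f => [|p ts IH] [|i] f.
- by rewrite /= big_seq1 /= bin0 mul1r (real_normK (num_real _)).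
- by rewrite /= big_nil expr0n /= mulr_ge0 ?sqr_ge0.
- rewrite /= big_map /=; apply: (le_trans (IH 0%N _)); rewrite !bin0 !mul1r.
  by apply: ler_cube => y; rewrite even_part_sqr lerDl sqr_ge0.
rewrite /= big_cat !big_map /=.
have := sqrrD_le _ _ _ _ _ _ (ler0n _ _) (sq0 ts _) (ler0n _ _) (sq0 ts _)
  (IH i.+1 (even_part p f)) (IH i (odd_part p f)).
rewrite -natrD -binS -cubeD => /le_trans; apply.
rewrite le_eqVlt; apply/orP; left; apply/eqP; congr (_ * cube ts _ x).
by apply: funext => y; rewrite even_part_sqr.
Qed.

Lemma level_norm_le k ts i f x : deg_le k ts f ->
  3 / 4 / 3 ^+ k * (\sum_(s <- masks (size ts) i) `|walsh s ts f x|) <=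
  Num.sqrt 'C(size ts, i)%:R * cube ts (fun y => `|f y|) x.
Proof.
move=> df; have c0 : 0 <= 3 / 4 / 3 ^+ k :> R by rewrite !divr_ge0 ?exprn_ge0.
have /(ler_wpM2l (sqrtr_ge0 'C(size ts, i)%:R)) := cube_norm_ge _ _ _ x df.
apply: le_trans; rewrite mulrCA ler_wpM2l // -sqrtrM //.
apply: (le_trans (ler_norm _)).
by rewrite -sqrtr_sqr ler_wsqrtr // level_le.
Qed.

Lemma walshD m ts f g x :
  walsh m ts (fun y => f y + g y) x = walsh m ts f x + walsh m ts g x.
Proof.
elim: m ts f g => [|b m IH] [|p ts] f g //=; rewrite -IH; congr (walsh m ts _ x).
by apply: funext => y; case: b; rewrite /even_part /odd_part; field.
Qed.

Lemma walshZ m ts (a : R) f x :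
  walsh m ts (fun y => a * f y) x = a * walsh m ts f x.
Proof.
elim: m ts f => [|b m IH] [|p ts] f //=; rewrite -IH; congr (walsh m ts _ x).
by apply: funext => y; case: b; rewrite /even_part /odd_part; field.
Qed.

(** Used with [phi] the swap of a pair disjoint from those in [ts], and with [phi] the difference
    along such a pair. *)
Lemma walsh_comp m ts f (phi : X -> X) x :
  {in ts, forall p y, phi (act p y) = act p (phi y)} ->
  walsh m ts (fun y => f (phi y)) x = walsh m ts f (phi x).
Proof.
elim: m ts f => [|b m IH] [|p ts] f //= phiC; rewrite -IH; last first.
  by move=> q qts; apply: phiC; rewrite inE qts orbT.
congr (walsh m ts _ x); apply: funext => y.
by case: b; rewrite /even_part /odd_part phiC ?mem_head.
Qed.

Lemma deg_leD k ts f g :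
  deg_le k ts f -> deg_le k ts g -> deg_le k ts (fun y => f y + g y).
Proof.
elim: ts k f g => [|p ts IH] k f g //= [ef of_] [eg og].
have -> : even_part p (fun y => f y + g y) =
    (fun y => even_part p f y + even_part p g y).
  by apply: funext => y; rewrite /even_part; field.
have -> : odd_part p (fun y => f y + g y) =
    (fun y => odd_part p f y + odd_part p g y).
  by apply: funext => y; rewrite /odd_part; field.
split; first exact: IH.
case: k of_ og {ef eg} => [|k] of_ og; last exact: IH.
by move=> x; rewrite of_ og addr0.
Qed.

Lemma deg_leZ k ts (a : R) f : deg_le k ts f -> deg_le k ts (fun y => a * f y).
Proof.
elim: ts k f => [|p ts IH] k f //= [ef of_].
have -> : even_part p (fun y => a * f y) = (fun y => a * even_part p f y).
  by apply: funext => y; rewrite /even_part; field.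
have -> : odd_part p (fun y => a * f y) = (fun y => a * odd_part p f y).
  by apply: funext => y; rewrite /odd_part; field.
split; first exact: IH.
case: k of_ {ef} => [|k] of_; last exact: IH.
by move=> x; rewrite of_ mulr0.
Qed.

Lemma deg_le_comp k ts f (phi : X -> X) :
  {in ts, forall p y, phi (act p y) = act p (phi y)} ->
  deg_le k ts f -> deg_le k ts (fun y => f (phi y)).
Proof.
elim: ts k f => [|p ts IH] k f //= phiC [ef of_].
have phiC' : {in ts, forall q y, phi (act q y) = act q (phi y)}.
  by move=> q qts; apply: phiC; rewrite inE qts orbT.
have -> : even_part p (fun y => f (phi y)) = (fun y => even_part p f (phi y)).
  by apply: funext => y; rewrite /even_part phiC ?mem_head.
have -> : odd_part p (fun y => f (phi y)) = (fun y => odd_part p f (phi y)).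
  by apply: funext => y; rewrite /odd_part phiC ?mem_head.
split; first exact: IH.
by case: k of_ {ef} => [|k] of_; [move=> x; exact: of_ | exact: IH].
Qed.

End Cube.

(** * Permutations, swaps and iterated differences of weightings *)

Section Hypergraph.
Context {R : realType} {T : finType}.
Implicit Types (w u : {set T} -> R) (s t : {perm T}) (V e : {set T}).
Implicit Types (p : T * T) (ps : seq (T * T)) (m : bitseq).

(** This is the weighting permuted by the inverse of [s]; sums over all permutations are insensitive
    to the inversion. *)
Definition wcomp s w : {set T} -> R := fun e => w (s @: e).
Definition wswap p w := wcomp (tperm p.1 p.2) w.

Definition endpoints ps := flatten [seq [:: p.1; p.2] | p <- ps].
(** Left folds, so that pairs are processed in the order in which the recursion of [Wc] picks
    them. *)
Definition Vminus V ps := foldl (fun V p => V :\ p.1 :\ p.2) V ps.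
Definition wdiffs ps w := foldl (fun w p => wdiff w p.1 p.2) w ps.
Definition map_pairs s ps := [seq (s p.1, s p.2) | p <- ps].

Lemma imset_perm_comp s t e : (s * t)%g @: e = t @: (s @: e).
Proof. by rewrite -imset_comp; apply: eq_imset => y /=; rewrite permM. Qed.

Lemma wcompM s t w : wcomp (s * t)%g w = wcomp s (wcomp t w).
Proof. by apply: funext => e; rewrite /wcomp imset_perm_comp. Qed.

Lemma imset_permK s e : s^-1%g @: (s @: e) = e.
Proof. by rewrite -imset_perm_comp mulgV (eq_imset _ (@perm1 T)) imset_id. Qed.

Lemma imset_permVK s e : s @: (s^-1%g @: e) = e.
Proof. by rewrite -imset_perm_comp mulVg (eq_imset _ (@perm1 T)) imset_id. Qed.

Lemma wdiff_wcomp s w (x y : T) :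
  wdiff (wcomp s w) x y = wcomp s (wdiff w (s x) (s y)).
Proof. by apply: funext => e; rewrite /wdiff /wcomp !imsetU1. Qed.

Lemma wdiffs_wcomp s ps w :
  wdiffs ps (wcomp s w) = wcomp s (wdiffs (map_pairs s ps) w).
Proof. by elim: ps w => [|p ps IH] w //=; rewrite wdiff_wcomp IH. Qed.

Lemma wdiff_wswap p (x y : T) w : x \notin [:: p.1; p.2] ->
  y \notin [:: p.1; p.2] -> wdiff (wswap p w) x y = wswap p (wdiff w x y).
Proof.
by rewrite /wswap wdiff_wcomp !inE !negb_or => /andP[x1 x2] /andP[y1 y2];
   rewrite !tpermD // eq_sym.
Qed.

Lemma wswapC p q w : uniq [:: p.1; p.2; q.1; q.2] ->
  wswap p (wswap q w) = wswap q (wswap p w).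
Proof.
rewrite /= !inE !negb_or => /and4P[/and3P[_ a b] /andP[c d] _ _].
by rewrite /wswap -!wcompM conjgC tpermJ !tpermD // eq_sym.
Qed.

Lemma in_Vminus V ps x : (x \in Vminus V ps) = (x \in V) && (x \notin endpoints ps).
Proof.
elim: ps V => [|p ps IH] V /=; first by rewrite andbT.
by rewrite IH !inE !negb_or; case: (x == p.1); case: (x == p.2);
   rewrite ?andbF ?andbT.
Qed.

Lemma wsum_wcomp k V s w : wsum k V (wcomp s w) = wsum k (s @: V) w.
Proof.
rewrite /wsum [RHS](reindex (fun e : {set T} => s @: e)) /=; last first.
  by exists (fun e => s^-1%g @: e) => e _; rewrite ?imset_permK ?imset_permVK.
apply: eq_bigl => e; rewrite card_imset; last exact: perm_inj.
congr andb; apply/idP/idP => [|h]; first exact: imsetS.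
by rewrite -(imset_permK s e) -(imset_permK s V); apply: imsetS.
Qed.

Lemma imset_permD1 s V (x : T) : s @: (V :\ x) = (s @: V) :\ s x.
Proof.
apply/setP => y; rewrite -(permKV s y) in_setD1.
by rewrite !mem_imset ?in_setD1 ?(inj_eq perm_inj) //; exact: perm_inj.
Qed.

Lemma Vminus_perm V s ps :
  s @: Vminus V ps = Vminus (s @: V) (map_pairs s ps).
Proof.
elim: ps V => [|p ps IH] V //=; rewrite IH; congr Vminus.
by rewrite !imset_permD1.
Qed.

Lemma setT_perm s : s @: [set: T] = [set: T].
Proof.
by apply/setP => x; rewrite inE -{1}(permKV s x) imset_f.
Qed.

(** With [j = k - i], the average of this over lists [ps] of [i] disjoint ordered pairs is the
    coordinate [W_i]. *)
Definition wnorm j ps w : R := W0 j (Vminus [set: T] ps) (wdiffs ps w).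

Lemma wnorm_wcomp j ps s w : wnorm j ps (wcomp s w) = wnorm j (map_pairs s ps) w.
Proof.
rewrite /wnorm /W0 wdiffs_wcomp wsum_wcomp Vminus_perm setT_perm.
suff -> : #|Vminus [set: T] (map_pairs s ps)| = #|Vminus [set: T] ps| by [].
by rewrite -{1}(setT_perm s) -Vminus_perm card_imset //; exact: perm_inj.
Qed.

Lemma hip_wcomp k s t w u :
  hip k [set: T] (wcomp s w) (wcomp t u) =
  hip k [set: T] (wcomp (t^-1 * s)%g w) u.
Proof.
rewrite /hip [RHS](reindex (fun e : {set T} => t @: e)) /=; last first.
  by exists (fun e => t^-1%g @: e) => e _; rewrite ?imset_permK ?imset_permVK.
apply: eq_big => e; first by rewrite !subsetT card_imset //; exact: perm_inj.
by rewrite /wcomp imset_perm_comp imset_permK.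
Qed.

(** * The inner product as a polynomial in the swaps *)

Lemma setD1C V (a b : T) : V :\ a :\ b = V :\ b :\ a.
Proof. by rewrite !setDDl setUC. Qed.

Lemma sum_link k V (a b : T) (F : {set T} -> R) : a \in V -> a != b ->
  \sum_(e : {set T} | (e \subset V) && (#|e| == k.+1)%N && ((a \in e) && (b \notin e)))
     F e =
  \sum_(e : {set T} | (e \subset V :\ a :\ b) && (#|e| == k)%N) F (a |: e).
Proof.
move=> aV ab.
rewrite (reindex_onto (fun e : {set T} => a |: e) (fun e => e :\ a)) /=; last first.
  by move=> e /andP[_ /andP[ae _]]; rewrite setD1K.
apply: eq_bigl => e; rewrite !subsetD1 !inE eqxx /= subUset sub1set aV /=.
rewrite (negbTE (_ : b != a)) /=; last by rewrite eq_sym.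
have [ae|ae] := boolP (a \in e).
  rewrite [(_ == e)](negbTE _) ?andbF //.
  by apply: contraL ae => /eqP <-; rewrite !inE eqxx.
by rewrite setU1K // eqxx !andbT cardsU1 ae add1n eqSS -!andbA; do !bool_congr.
Qed.

(** Edges containing both or neither of the endpoints [a], [b] are fixed by the swap and cancel. The
    others are [a |: e] and [b |: e] with [e] avoiding both, and the four terms belonging to one [e]
    factor as a product of two differences. *)
Lemma hip_odd_part k V w u p : p.1 \in V -> p.2 \in V -> p.1 != p.2 ->
  (hip k.+1 V w u - hip k.+1 V (wswap p w) u) / 2 =
  2^-1 * hip k (V :\ p.1 :\ p.2) (wdiff w p.1 p.2) (wdiff u p.1 p.2).
Proof.
case: p => a b /= aV bV ab; rewrite mulrC; congr (_ * _).
have ba : b != a by rewrite eq_sym.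
rewrite /hip -sumrB.
rewrite (bigID (fun e : {set T} => (a \in e) && (b \notin e))) /= sum_link //.
rewrite [X in _ + X](bigID (fun e : {set T} => (b \in e) && (a \notin e))) /=.
rewrite [X in _ + (_ + X)]big1 ?addr0; last first.
  move=> e h; rewrite /wswap /wcomp /=.
  suff -> : tperm a b @: e = e by rewrite subrr.
  have e_ab : (a \in e) = (b \in e).
    by move: h; case: (a \in e); case: (b \in e); rewrite ?andbF.
  apply/setP => x; rewrite -{1}[x](tpermK a b) mem_imset; last exact: perm_inj.
  by case: tpermP => [->|->|].
rewrite [X in _ + X](eq_bigl (fun e : {set T} => (e \subset V) && (#|e| == k.+1)%N &&
   ((b \in e) && (a \notin e)))); last first.
  move=> e; case: (a \in e); case: (b \in e); rewrite ?andbF ?andbT //.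
rewrite sum_link // setD1C -big_split /=; apply: eq_bigr => e /andP[].
rewrite !subsetD1 => /andP[/andP[_ be] ae] _.
have fix_e : tperm a b @: e = e.
  rewrite -[RHS]imset_id; apply: eq_in_imset => x xe /=.
  by rewrite tpermD //; apply: contraTneq xe => <-.
rewrite /wswap /wcomp /wdiff /= !imsetU1 fix_e tpermL tpermR; ring.
Qed.

Definition disj_pairs V ps := uniq (endpoints ps) && all (mem V) (endpoints ps).

Lemma disj_pairs_cons V p ps : disj_pairs V (p :: ps) ->
  [/\ p.1 \in V, p.2 \in V, p.1 != p.2, disj_pairs (V :\ p.1 :\ p.2) ps &
      {in ps, forall q, uniq [:: p.1; p.2; q.1; q.2]}].
Proof.
rewrite /disj_pairs /= inE negb_or.
move=> /andP[/and3P[/andP[p12 p1] p2 up] /and3P[p1V p2V /allP pV]].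
split=> //.
  rewrite up; apply/allP => x xps; have /= := pV x xps.
  rewrite !inE => ->; rewrite andbT; apply/andP; split.
    by apply: contraNneq p2 => <-.
  by apply: contraNneq p1 => <-.
elim: ps p1 p2 up {pV} => [|r ps IH] //= p1 p2 up q; rewrite inE => /orP[/eqP->|].
  move: p1 p2 up; rewrite !inE !negb_or => /and3P[-> -> _] /and3P[-> -> _].
  by rewrite p12 => /andP[/andP[-> _] _].
apply: IH; [move: p1|move: p2|by case/and3P: up];
  by rewrite !inE !negb_or => /and3P[].
Qed.

Lemma disj_pairs_sub V V' ps : V \subset V' -> disj_pairs V ps -> disj_pairs V' ps.
Proof.
move=> /subsetP VV' /andP[ups /allP pV]; apply/andP; split=> //.
by apply/allP => x /pV; exact: VV'.
Qed.

(** Each odd part lowers the uniformity by one, by [hip_odd_part], and at uniformity 0 only the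
    empty edge is left, which no swap moves. *)
Lemma deg_hip k V u ts : disj_pairs V ts ->
  deg_le wswap k ts (fun w => hip k V w u).
Proof.
elim: ts k V u => [|p ts IH] k V u //= /disj_pairs_cons[p1V p2V p12 dts cts].
have dtsV : disj_pairs V ts.
  by apply: disj_pairs_sub dts; rewrite (subset_trans (subD1set _ _)) ?subD1set.
split.
  have -> : even_part wswap p (fun w => hip k V w u) =
     (fun w => 2^-1 * (hip k V w u + hip k V (wswap p w) u)).
    by apply: funext => w; rewrite /even_part mulrC.
  apply: deg_leZ; apply: deg_leD; first exact: IH.
  apply: (deg_le_comp wswap k ts (fun w => hip k V w u) (wswap p)); last exact: IH.
  by move=> q qts w; apply: wswapC; apply: cts.
case: k => [|k].
  move=> w; rewrite /odd_part /hip -sumrB big1 ?mul0r // => e.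
  move=> /andP[_ /eqP/cards0_eq ->].
  by rewrite /wswap /wcomp imset0 subrr.
have -> : odd_part wswap p (fun w => hip k.+1 V w u) = (fun w => 2^-1 *
    hip k (V :\ p.1 :\ p.2) (wdiff w p.1 p.2) (wdiff u p.1 p.2)).
  by apply: funext => w; rewrite /odd_part hip_odd_part.
apply: deg_leZ; apply: (deg_le_comp wswap k ts
  (fun w => hip k (V :\ p.1 :\ p.2) w (wdiff u p.1 p.2))
  (fun w => wdiff w p.1 p.2)); last exact: IH.
move=> q /cts; rewrite /= !inE !negb_or.
by move=> /and4P[/and3P[_ a b] /andP[c d] _ _] w;
   rewrite wdiff_wswap // !inE !negb_or ?a ?b ?c ?d.
Qed.

(** Each selected pair contributes a factor 1/2 and a difference. Invariance of [w] under the
    unselected swaps makes the corresponding even parts trivial at [w]; averaging by [wavg] will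
    provide it. *)
Lemma walsh_hip k V u w ts m : disj_pairs V ts -> size m = size ts ->
  (count id m <= k)%N -> {in mask (map negb m) ts, forall p, wswap p w = w} ->
  walsh wswap m ts (fun w => hip k V w u) w = 2^-1 ^+ count id m *
  hip (k - count id m) (Vminus V (mask m ts)) (wdiffs (mask m ts) w)
                       (wdiffs (mask m ts) u).
Proof.
elim: m k V u w ts => [|b m IH] k V u w [|p ts] //=.
  by rewrite subn0 expr0 mul1r.
move=> /disj_pairs_cons[p1V p2V p12 dts cts] [sz].
have comm (x : T) : {in ts, forall q, x \in [:: p.1; p.2] -> x \notin [:: q.1; q.2]}.
  move=> q /cts; rewrite /= !inE !negb_or.
  move=> /and4P[/and3P[_ a b'] /andP[c d] _ _].
  by move=> /orP[]/eqP->; rewrite ?a ?b' ?c ?d.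
case: b => /= cle winv.
  case: k cle => // k; rewrite add1n ltnS subSS => cle.
  have -> : odd_part wswap p (fun w => hip k.+1 V w u) = (fun w => 2^-1 *
      hip k (V :\ p.1 :\ p.2) (wdiff w p.1 p.2) (wdiff u p.1 p.2)).
    by apply: funext => w'; rewrite /odd_part hip_odd_part.
  rewrite walshZ (walsh_comp wswap m ts
    (fun w => hip k (V :\ p.1 :\ p.2) w (wdiff u p.1 p.2))
    (fun w => wdiff w p.1 p.2)); last first.
    by move=> q qts w'; rewrite wdiff_wswap // comm // !inE eqxx ?orbT.
  rewrite IH // ?exprS ?mulrA // => q qts.
  have qin : q \in ts by rewrite (mem_mask qts).
  by rewrite -wdiff_wswap ?winv // comm // !inE eqxx ?orbT.
rewrite add0n in cle *.
have -> : even_part wswap p (fun w => hip k V w u) =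
     (fun w => 2^-1 * (hip k V w u + hip k V (wswap p w) u)).
  by apply: funext => w'; rewrite /even_part mulrC.
rewrite walshZ walshD (walsh_comp wswap m ts (fun w => hip k V w u) (wswap p));
  last by move=> q qts w'; apply: wswapC; apply: cts.
rewrite winv ?mem_head //.
have -> (z : R) : 2^-1 * (z + z) = z by field.
apply: IH => //.
  by apply: disj_pairs_sub dts; rewrite (subset_trans (subD1set _ _)) ?subD1set.
by move=> q qts; apply: winv; rewrite inE qts orbT.
Qed.

(** * Averaging over the permutations supported on a vertex set *)

Lemma perm_on_seq V (xs ys : seq T) : uniq xs -> uniq ys -> size xs = size ys ->
  all (mem V) xs -> all (mem V) ys ->
  exists2 s, perm_on V s & map s xs = ys.
Proof.
elim: xs ys => [|x xs IH] [|y ys] //=.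
  by move=> *; exists 1%g => //; exact: perm_on1.
move=> /andP[xxs uxs] /andP[yys uys] [sz] /andP[xV xsV] /andP[yV ysV].
have [s sV sxy] := IH ys uxs uys sz xsV ysV.
(* Once [xs] is sent to [ys], exchanging [s x] with [y] settles [x]; neither of the two lies in
   [ys]. *)
exists (s * tperm (s x) y)%g.
  apply: perm_onM => //; apply: (subset_trans (tperm_on _ _)).
  rewrite subUset !sub1set (perm_closed _ sV). by apply/andP.
rewrite permM tpermL; congr cons; rewrite -sxy; apply/eq_in_map => z zxs.
rewrite permM tpermD //; first by rewrite (inj_eq perm_inj); apply: contraNneq xxs => ->.
by apply: contraNneq yys => ->; rewrite -sxy map_f.
Qed.

Definition perms_on V : {set {perm T}} := [set s | perm_on V s].

(** Averaging gives invariance under swaps inside [V] without affecting differences along pairs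
    outside [V]. *)
Definition wavg V w : {set T} -> R :=
  fun e => #|perms_on V|%:R^-1 * \sum_(s in perms_on V) wcomp s w e.

Lemma card_perms_on_gt0 V : 0 < #|perms_on V|%:R :> R.
Proof. by rewrite ltr0n; apply/card_gt0P; exists 1%g; rewrite inE perm_on1. Qed.

Lemma wcomp_wavg V s w : perm_on V s -> wcomp s (wavg V w) = wavg V w.
Proof.
move=> sV; apply: funext => e; rewrite {1}/wcomp /wavg; congr (_ * _).
rewrite [RHS](reindex_inj (mulgI s)) /=; apply: eq_big => [t|t _].
  rewrite !inE; apply/idP/idP => [|h]; first exact: perm_onM.
  by rewrite -(mulKg s t) perm_onM ?perm_onV.
by rewrite wcompM.
Qed.

Lemma wdiff_wavg V w (x y : T) : x \notin V -> y \notin V ->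
  wdiff (wavg V w) x y = wavg V (wdiff w x y).
Proof.
move=> xV yV; apply: funext => e; rewrite /wdiff /wavg -mulrBr -sumrB.
congr (_ * _); apply: eq_bigr => s; rewrite inE => sV.
by rewrite -[LHS]/(wdiff (wcomp s w) x y e) wdiff_wcomp !(out_perm sV).
Qed.

Lemma wdiffs_wavg V ps w : {in endpoints ps, forall x, x \notin V} ->
  wdiffs ps (wavg V w) = wavg V (wdiffs ps w).
Proof.
elim: ps w => [|p ps IH] w //= h.
rewrite wdiff_wavg ?IH // => [x xps| |]; apply: h; rewrite !inE ?eqxx ?orbT //.
by rewrite xps !orbT.
Qed.

(** The permutations supported on [V] act transitively on its [j]-subsets, so [wavg V w] is constant
    on them, and averaging preserves the total weight. *)
Lemma wavg_const j V w e : e \subset V -> #|e| = j ->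
  wavg V w e = wsum j V w / 'C(#|V|, j)%:R.
Proof.
move=> eV ej.
have C0 : 'C(#|V|, j)%:R != 0 :> R.
  by rewrite pnatr_eq0 -lt0n bin_gt0 -ej subset_leq_card.
apply: (mulIf C0); rewrite divfK //.
have tot : wsum j V (wavg V w) = wsum j V w.
  rewrite /wsum /wavg -mulr_sumr exchange_big /=.
  rewrite (eq_bigr (fun=> wsum j V w)); last first.
    move=> s; rewrite inE => sV; rewrite -[LHS]/(wsum j V (wcomp s w)).
    by rewrite wsum_wcomp im_perm_on.
  rewrite sumr_const -[wsum _ _ _ *+ _]mulr_natl mulKf // gt_eqF // card_perms_on_gt0 //.
rewrite -tot /wsum (eq_bigr (fun=> wavg V w e)); last first.
  move=> e2 /andP[e2V /eqP e2j].
  have [|||s sV se] := perm_on_seq V (enum e2) (enum e) (enum_uniq _) (enum_uniq _).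
  - by rewrite -!cardE e2j.
  - by apply/allP => x; rewrite mem_enum; exact: (subsetP e2V).
  - by apply/allP => x; rewrite mem_enum; exact: (subsetP eV).
  rewrite -[in LHS](wcomp_wavg V s) // /wcomp; congr (wavg V w _).
  apply/setP => x; rewrite -(mem_enum e) -se; apply/imsetP/mapP => -[y ye ->];
    by exists y => //; rewrite mem_enum in ye *.
rewrite sumr_const -[RHS]mulr_natr; congr (_ * _%:R).
rewrite -(cards_draws V j) cardsE; exact: eq_card.
Qed.

Lemma hip_wavg j V w u :
  hip j V (wavg V w) u = wsum j V w * wsum j V u / 'C(#|V|, j)%:R.
Proof.
rewrite /hip (eq_bigr (fun e => wsum j V w / 'C(#|V|, j)%:R * u e)).
  by rewrite -mulr_sumr mulrAC.
by move=> e /andP[eV /eqP ej]; rewrite (wavg_const j).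
Qed.

(** Linearity is encoded by an explicit kernel, so that commuting with [wavg] is an exchange of
    finite sums. *)
Definition linear_form (f : ({set T} -> R) -> R) :=
  exists g : {set T} -> R, forall w, f w = \sum_e w e * g e.

Lemma linear_form_hip k V u : linear_form (fun w => hip k V w u).
Proof.
exists (fun e => if (e \subset V) && (#|e| == k)%N then u e else 0) => w.
rewrite /hip big_mkcond /=; apply: eq_bigr => e _.
by case: ifP => _; rewrite ?mulr0.
Qed.

Lemma linear_form_walsh m ts f : linear_form f -> linear_form (walsh wswap m ts f).
Proof.
elim: m ts f => [|b m IH] [|p ts] f //= [g fg]; apply: IH.
exists (fun e => (g e + (if b then -1 else 1) * g (tperm p.1 p.2 @: e)) / 2) => w.
have swp : f (wswap p w) = \sum_e w e * g (tperm p.1 p.2 @: e).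
  rewrite fg (reindex_inj (imset_inj (@perm_inj _ (tperm p.1 p.2)))) /=.
  apply: eq_bigr => e _; congr (w _ * _).
  by rewrite -[RHS](imset_permK (tperm p.1 p.2)) tpermV.
case: b; rewrite /odd_part /even_part swp fg ?mulN1r.
  by rewrite -sumrB mulr_suml; apply: eq_bigr => e _; field.
by rewrite -big_split mulr_suml; apply: eq_bigr => e _ /=; field.
Qed.

Lemma linear_form_wavg f V w : linear_form f ->
  f (wavg V w) = #|perms_on V|%:R^-1 * \sum_(s in perms_on V) f (wcomp s w).
Proof.
move=> [g fg]; rewrite fg; under [in RHS]eq_bigr do rewrite fg.
rewrite exchange_big mulr_sumr; apply: eq_bigr => e _ /=.
by rewrite /wavg -mulrA mulr_suml.
Qed.

(* Jensen's inequality, since left translation by [perms_on V0] preserves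
   the sum over all permutations. *)
Lemma sum_norm_wavg f V0 w : linear_form f ->
  \sum_s `|f (wavg V0 (wcomp s w))| <= \sum_s `|f (wcomp s w)|.
Proof.
move=> lf; pose N : R := #|perms_on V0|%:R.
apply: (@le_trans _ _ (N^-1 *
  \sum_s \sum_(t in perms_on V0) `|f (wcomp t (wcomp s w))|)).
  rewrite mulr_sumr; apply: ler_sum => s _.
  rewrite linear_form_wavg // normrM ger0_norm ?invr_ge0 ?ler0n //.
  by rewrite ler_wpM2l ?invr_ge0 ?ler0n // ler_norm_sum.
rewrite exchange_big /= (eq_bigr (fun=> \sum_s `|f (wcomp s w)|)); last first.
  move=> t _; rewrite [RHS](reindex_inj (mulgI t)) /=.
  by apply: eq_bigr => s _; rewrite wcompM.
rewrite sumr_const -[X in _ * X]mulr_natl mulKf // gt_eqF // card_perms_on_gt0 //.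
Qed.

Lemma card_Vminus V ps : disj_pairs V ps -> (#|V| = #|Vminus V ps| + 2 * size ps)%N.
Proof.
elim: ps V => [|p ps IH] V //=; first by rewrite muln0 addn0.
move=> /disj_pairs_cons[p1V p2V p12 dps _].
rewrite (cardsD1 p.1 V) p1V (cardsD1 p.2) !inE eq_sym p12 p2V (IH _ dps) /=.
lia.
Qed.

Lemma endpoints_mask m ts x : x \in endpoints (mask m ts) -> x \in endpoints ts.
Proof.
by move=> /flatten_mapP[p pm xp]; apply/flatten_mapP; exists p => //; exact: mem_mask pm.
Qed.

Lemma disj_pairs_mask V ts m : disj_pairs V ts -> disj_pairs V (mask m ts).
Proof.
move=> /andP[uts /allP tV]; apply/andP; split; last first.
  by apply/allP => x /endpoints_mask; exact: tV.
elim: ts m uts {tV} => [|p ts IH] [|[] m] //=; first last.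
  by move=> /and3P[_ _]; exact: IH.
rewrite !inE !negb_or => /and3P[/andP[-> a] b uts].
by rewrite (contra (@endpoints_mask _ _ _) a) (contra (@endpoints_mask _ _ _) b) IH.
Qed.

Lemma endpoints_maskN m ts x : uniq (endpoints ts) -> x \in endpoints (mask (map negb m) ts) ->
  x \notin endpoints (mask m ts).
Proof.
elim: m ts => [|b m IH] [|p ts] //= /and3P[].
rewrite !inE !negb_or => /andP[p12 p1] p2 uts.
case: b => /=; rewrite ?inE.
  move=> xm; rewrite !negb_or IH // andbT.
  by apply/andP; split; [apply: contraNneq p1|apply: contraNneq p2] => <-;
     exact: endpoints_mask xm.
move=> /or3P[/eqP->|/eqP->|]; [| |exact: IH].
  by apply: contra p1; exact: endpoints_mask.
by apply: contra p2; exact: endpoints_mask.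
Qed.

(** Jensen replaces [w] by its average over the vertices [V] outside the selected pairs. The
    unselected pairs lie in [V], so [walsh_hip] applies, and [hip_wavg] evaluates the inner product
    left over. Each [wnorm] divides by the binomial and the inner product only once, so one binomial
    factor remains. *)
Lemma sum_norm_walsh_ge k u w ts m : disj_pairs [set: T] ts -> size m = size ts ->
  (count id m <= k)%N -> (2 * k < #|T|)%N ->
  2^-1 ^+ count id m * 'C(#|T| - 2 * count id m, k - count id m)%:R *
   wnorm (k - count id m) (mask m ts) u *
   \sum_s wnorm (k - count id m) (mask m ts) (wcomp s w) <=
  \sum_s `|walsh wswap m ts (fun w => hip k [set: T] w u) (wcomp s w)|.
Proof.
move=> dts sz cle nk; set i := count id m; set ps := mask m ts.
pose V := Vminus [set: T] ps.
have cV : #|V| = (#|T| - 2 * i)%N.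
  have := card_Vminus _ _ (disj_pairs_mask _ _ m dts).
  by rewrite cardsT size_mask // -/i => ->; rewrite addnK.
apply: le_trans (sum_norm_wavg _ V w (linear_form_walsh m ts _
   (linear_form_hip k [set: T] u))).
rewrite mulr_sumr; apply: ler_sum => s _.
have uts := proj1 (andP dts).
rewrite walsh_hip //; last first.
  move=> p pm; rewrite /wswap wcomp_wavg //.
  have inV x : x \in [:: p.1; p.2] -> x \in V.
    move=> xp; rewrite in_Vminus inE /= endpoints_maskN //.
    by apply/flatten_mapP; exists p.
  apply: (subset_trans (tperm_on _ _)).
  by rewrite subUset !sub1set !inV // !inE eqxx ?orbT.
rewrite wdiffs_wavg; last by move=> x xps; rewrite in_Vminus xps andbF.
rewrite -/V -/ps -/i hip_wavg /wnorm /W0 -/V cV.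
have C0 : 'C(#|T| - 2 * i, k - i)%:R != 0 :> R.
  by rewrite pnatr_eq0 -lt0n bin_gt0; rewrite -/i in cle; lia.
rewrite !normrM [`|2^-1 ^+ i|]ger0_norm ?exprn_ge0 ?invr_ge0 //.
rewrite normfV [`|_%:R|]ger0_norm // le_eqVlt; apply/orP; left; apply/eqP.
by field.
Qed.

(** * The W-vector as an average over lists of disjoint pairs *)

Fixpoint pair_avg i V (N : seq (T * T) -> R) : R :=
  if i is i'.+1 then
    ((#|V| * (#|V| - 1))%:R)^-1 *
    \sum_(x in V) \sum_(y in V | y != x)
      pair_avg i' (V :\ x :\ y) (fun ps => N ((x, y) :: ps))
  else N [::].

Lemma Wc_pair_avg k i V w : (i <= k)%N -> Wc k i V w =
  pair_avg i V (fun ps => W0 (k - i) (Vminus V ps) (wdiffs ps w)).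
Proof.
elim: i k V w => [|i IH] [|k] V w //= ik; congr (_ * _).
by apply: eq_bigr => x _; apply: eq_bigr => y _; rewrite IH.
Qed.

Lemma Wc_ge0 k i V w : 0 <= Wc k i V w.
Proof.
elim: i k V w => [|i IH] [|k] V w //=; rewrite ?divr_ge0 // mulr_ge0 ?invr_ge0 //.
by apply: sumr_ge0 => x _; apply: sumr_ge0 => y _.
Qed.

Lemma pair_avg_sum (I : finType) i V (N : I -> seq (T * T) -> R) :
  pair_avg i V (fun ps => \sum_s N s ps) = \sum_s pair_avg i V (N s).
Proof.
elim: i V N => [|i IH] V N //=; rewrite -mulr_sumr; congr (_ * _).
rewrite exchange_big; apply: eq_bigr => x _ /=.
by rewrite exchange_big; apply: eq_bigr => y _ /=; rewrite IH.
Qed.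

Lemma pair_avg_perm i V s (N : seq (T * T) -> R) :
  pair_avg i V (fun ps => N (map_pairs s ps)) = pair_avg i (s @: V) N.
Proof.
have sinj := @perm_inj _ s.
elim: i V N => [|i IH] V N //=; rewrite card_imset //; congr (_ * _).
rewrite [RHS](reindex_inj sinj) /=; apply: eq_big => x; first by rewrite mem_imset.
move=> _; rewrite [RHS](reindex_inj sinj) /=; apply: eq_big => y.
  by rewrite mem_imset // (inj_eq sinj).
by move=> _; rewrite -!imset_permD1 -IH.
Qed.

(** The size hypothesis keeps every normalising factor nonzero, so that the nested averages have
    total weight 1. *)
Lemma pair_avg_const i V (N : seq (T * T) -> R) (c : R) : (2 * i <= #|V|)%N ->
  (forall ps, size ps = i -> disj_pairs V ps -> N ps = c) -> pair_avg i V N = c.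
Proof.
elim: i V N => [|i IH] V N iV Nc /=; first exact: Nc.
have inner x y : x \in V -> (y \in V) && (y != x) ->
    pair_avg i (V :\ x :\ y) (fun ps => N ((x, y) :: ps)) = c.
  move=> xV /andP[yV yx]; apply: IH.
    by move: iV; rewrite (cardsD1 x V) xV (cardsD1 y) !inE yx yV; lia.
  move=> ps sps /andP[ups /allP psV]; apply: Nc; first by rewrite /= sps.
  have xps : x \notin endpoints ps by apply/negP => /psV; rewrite /= !inE eqxx andbF.
  have yps : y \notin endpoints ps by apply/negP => /psV; rewrite /= !inE eqxx.
  rewrite /disj_pairs /= inE negb_or eq_sym yx xps yps ups xV yV /=.
  by apply/allP => z /psV; rewrite /= !inE => /and3P[].
rewrite (eq_bigr (fun=> (#|V| - 1)%:R * c)); last first.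
  move=> x xV; rewrite (eq_bigr (fun=> c)); last by move=> y; exact: inner.
  rewrite sumr_const mulr_natl; congr (_ *+ _).
  rewrite (cardsD1 x V) xV add1n subn1 /=; apply: eq_card => y.
  by rewrite !inE andbC.
rewrite sumr_const -[X in _ * X]mulr_natl mulrA -natrM mulKf //.
by rewrite pnatr_eq0; lia.
Qed.

Lemma endpoints_map_pairs s ps : endpoints (map_pairs s ps) = map s (endpoints ps).
Proof. by elim: ps => [|p ps IH] //=; congr [:: _, _ & _]. Qed.

Lemma endpoints_inj ps qs : endpoints ps = endpoints qs -> ps = qs.
Proof.
by elim: ps qs => [|[a b] ps IH] [|[c d] qs] //= [-> -> /IH ->].
Qed.

Lemma size_endpoints ps : size (endpoints ps) = (2 * size ps)%N.
Proof. by elim: ps => [|p ps IH] //=; rewrite -/(endpoints ps) IH; lia. Qed.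

(* The left side does not depend on [ps], as permutations act transitively on
   lists of disjoint pairs, so it may be averaged over [ps]. *)
Lemma sum_map_pairs i ps (N : seq (T * T) -> R) : disj_pairs [set: T] ps ->
  size ps = i -> (2 * i <= #|T|)%N ->
  \sum_(s : {perm T}) N (map_pairs s ps) = #|{perm T}|%:R * pair_avg i [set: T] N.
Proof.
move=> /andP[ups psT] sps iT.
transitivity (pair_avg i [set: T] (fun qs => \sum_(s : {perm T}) N (map_pairs s qs))).
  symmetry; apply: pair_avg_const; first by rewrite cardsT.
  move=> qs sqs /andP[uqs qsT].
  have [|t _ tps] := perm_on_seq _ _ _ ups uqs _ psT qsT.
    by rewrite !size_endpoints sps sqs.
  have -> : qs = map_pairs t ps by apply: endpoints_inj; rewrite endpoints_map_pairs.
  rewrite [RHS](reindex_inj (mulgI t)) /=; apply: eq_bigr => s _; congr N.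
  by rewrite /map_pairs -map_comp; apply: eq_map => p /=; rewrite !permM.
rewrite pair_avg_sum (eq_bigr (fun=> pair_avg i [set: T] N)); last first.
  by move=> s _; rewrite pair_avg_perm setT_perm.
by rewrite sumr_const -[LHS]mulr_natl.
Qed.

Lemma sum_wnorm k i ps w : disj_pairs [set: T] ps -> size ps = i ->
  (i <= k)%N -> (2 * i <= #|T|)%N ->
  \sum_s wnorm (k - i) ps (wcomp s w) = #|{perm T}|%:R * Wc k i [set: T] w.
Proof.
move=> dps sps ik iT; under eq_bigr do rewrite wnorm_wcomp.
by rewrite (sum_map_pairs i ps (fun ps => wnorm (k - i) ps w)) // Wc_pair_avg.
Qed.

(** * The lower bound coming from a single degree *)

Lemma sum_cube ts (phi : ({set T} -> R) -> R) w :
  \sum_s cube wswap ts phi (wcomp s w) = \sum_s phi (wcomp s w).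
Proof.
elim: ts phi => [|p ts IH] phi //=; rewrite IH.
rewrite /even_part -mulr_suml big_split /=.
suff -> : \sum_s phi (wswap p (wcomp s w)) = \sum_s phi (wcomp s w) by field.
(* A swap is a left translation of the symmetric group, so it preserves the sum over all
   permutations. *)
rewrite [RHS](reindex_inj (mulgI (tperm p.1 p.2))) /=.
by apply: eq_bigr => s _; rewrite /wswap wcompM.
Qed.

Lemma exists_pairs : exists2 ts, disj_pairs [set: T] ts & size ts = #|T|./2.
Proof.
suff H : forall j (r : seq T), uniq r -> (2 * j <= size r)%N ->
    exists ts, [/\ uniq (endpoints ts), {subset endpoints ts <= r} & size ts = j].
  have [|ts [uts _ sts]] := H #|T|./2 (enum T) (enum_uniq _).
    by rewrite -cardE mul2n -geq_half_double.
  exists ts => //; rewrite /disj_pairs uts; apply/allP => x _; exact: in_setT.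
elim=> [|j IH] r; first by exists [::].
case: r => [|a [|b r]] //=; first by lia.
rewrite inE negb_or => /and3P[/andP[ab ar] br ur] jr.
have [|ts [uts tsr sts]] := IH r ur; first by lia.
exists ((a, b) :: ts); split=> /=; last by rewrite sts.
  rewrite inE negb_or ab uts (contra (tsr a) ar) (contra (tsr b) br) //.
by move=> x; rewrite !inE => /or3P[->|->|/tsr ->]; rewrite ?orbT.
Qed.

Lemma sum_hip_ge k i w u : (i <= k)%N -> (2 * k < #|T|)%N ->
  3 / 4 / 3 ^+ k * 2^-1 ^+ i * Num.sqrt 'C(#|T|./2, i)%:R *
  'C(#|T| - 2 * i, k - i)%:R * #|{perm T}|%:R *
  (Wc k i [set: T] w * Wc k i [set: T] u) <=
  \sum_s `|hip k [set: T] (wcomp s w) u|.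
Proof.
move=> ik kT; have [ts dts sts] := exists_pairs.
set S := \sum_s _; set K : R := 3 / 4 / 3 ^+ k; set C : R := 'C(#|T|./2, i)%:R.
set C' : R := 'C(#|T| - _, _)%:R; set M : R := #|{perm T}|%:R.
have K0 : 0 <= K by rewrite !divr_ge0 ?exprn_ge0.
have M0 : 0 < M by rewrite ltr0n; apply/card_gt0P; exists 1%g.
have C0 : 0 < C by rewrite ltr0n bin_gt0 geq_half_double -mul2n; lia.
have Nu t : \sum_s `|hip k [set: T] (wcomp s w) (wcomp t u)| = S.
  rewrite [LHS](reindex_inj (mulgI t)); apply: eq_bigr => s _.
  by rewrite hip_wcomp mulKg.
(* Replacing [u] by [wcomp t u] leaves the sum unchanged; averaging over [t]
   makes the pairs in [ts] random for [u] as well. *)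
have bound t : K * \sum_(m <- masks #|T|./2 i) (2^-1 ^+ i * C' *
    wnorm (k - i) (mask m ts) (wcomp t u) * (M * Wc k i [set: T] w)) <=
    Num.sqrt C * S.
  rewrite -(Nu t) -(sum_cube ts (fun w => `|hip k [set: T] w (wcomp t u)|)).
  rewrite [leRHS]mulr_sumr.
  apply: (@le_trans _ _ (\sum_s K * \sum_(m <- masks #|T|./2 i)
    `|walsh wswap m ts (fun w => hip k [set: T] w (wcomp t u)) (wcomp s w)|)).
    rewrite -mulr_sumr ler_wpM2l // exchange_big /= big_seq [leRHS]big_seq.
    apply: ler_sum => m /masksP[sm cm].
    rewrite -(sum_wnorm k i (mask m ts)) //; last by lia.
    - by have := sum_norm_walsh_ge k (wcomp t u) w ts m dts; rewrite cm; apply;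
         rewrite ?sm ?sts.
    - exact: disj_pairs_mask.
    - by rewrite size_mask // sm sts.
  apply: ler_sum => s _; rewrite /C -sts.
  by apply: level_norm_le; exact: deg_hip.
have : \sum_t (K * \sum_(m <- masks #|T|./2 i) (2^-1 ^+ i * C' *
    wnorm (k - i) (mask m ts) (wcomp t u) * (M * Wc k i [set: T] w))) <=
    \sum_(t : {perm T}) Num.sqrt C * S by apply: ler_sum.
rewrite sumr_const -[X in _ <= X]mulr_natl -/M -mulr_sumr exchange_big /=.
rewrite (_ : \sum_(m <- _) _ = C * (2^-1 ^+ i * C' * (M * Wc k i [set: T] u) *
   (M * Wc k i [set: T] w))); last first.
  rewrite big_seq (eq_bigr (fun=> 2^-1 ^+ i * C' * (M * Wc k i [set: T] u) *
     (M * Wc k i [set: T] w))); last first.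
    move=> m /masksP[sm cm]; rewrite -mulr_suml -mulr_sumr.
    rewrite sum_wnorm //; last by lia.
      exact: disj_pairs_mask.
    by rewrite size_mask // sm sts.
  by rewrite -big_seq big_const_seq count_predT size_masks iter_addr_0 -[LHS]mulr_natl.
(* All [C] sets of [i] pairs contribute equally, while the right side carries only the square root
   of [C]. Cancelling that root leaves one on the left. *)
rewrite -{1}(sqr_sqrtr (ltW C0)).
have sC0 : 0 < Num.sqrt C by rewrite sqrtr_gt0.
set c := Num.sqrt C in sC0 *; set Ww := Wc k i _ w; set Wu := Wc k i _ u.
have -> : K * (c ^+ 2 * (2^-1 ^+ i * C' * (M * Wu) * (M * Ww))) =
   (M * c) * (K * 2^-1 ^+ i * c * C' * M * (Ww * Wu)) by ring.
by rewrite [M * (c * S)]mulrA ler_pM2l // mulr_gt0.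
Qed.

End Hypergraph.

(** * Binomial estimates and the final constant *)

Lemma expn_le_bin (m j : nat) : (j <= m)%N -> (m ^ j <= 'C(m, j) * (j`! * j`!))%N.
Proof.
rewrite mulnA bin_ffact; elim: j => [|j IH] jm; first by rewrite ffactn0 fact0.
rewrite expnS ffactnSr factS.
(* The difference of the two sides is [j * (m - j - 1)], and [j < m] here. *)
have step : (m <= (m - j) * j.+1)%N by nia.
have := leq_mul step (IH (ltnW jm)).
by rewrite (_ : _ * _ * (_ * _) = m ^_ j * (m - j) * (j.+1 * j`!))%N //; lia.
Qed.

Lemma exp_natr_le_bin {R : realType} (a n m j : nat) :
  (j <= m)%N -> (n <= a * m)%N ->
  n%:R ^+ j <= (a%:R ^+ j * (j`!)%:R ^+ 2) * 'C(m, j)%:R :> R.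
Proof.
move=> jm nam; rewrite -!natrX -!natrM ler_nat.
apply: (@leq_trans ((a * m) ^ j)%N); first by case: (j) => // i; rewrite leq_exp2r.
by rewrite expnMn -mulnA leq_mul2l mulnC expn_le_bin ?orbT.
Qed.

Lemma Eperm_ge {R : realType} (k i : nat) : (1 <= k)%N -> (i <= k)%N ->
  exists2 c : R, 0 < c & forall (n : nat) (w u : {set 'I_n} -> R), (2 * k < n)%N ->
    c * (n%:R ^+ k * Num.sqrt n%:R ^- i *
         Wc k i [set: 'I_n] w * Wc k i [set: 'I_n] u) <= Eperm k w u.
Proof.
move=> k1 ik.
(* The bases come from [n <= 4 * n./2] and [n <= (2 * k).+1 * (n - 2 * i)], both consequences of
   [2 * k < n] with [1 <= k] and [i <= k]. *)
pose a : R := 4%:R ^+ i * (i`!)%:R ^+ 2.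
pose b : R := (2 * k).+1%:R ^+ (k - i) * ((k - i)`!)%:R ^+ 2.
have a0 : 0 < a by rewrite mulr_gt0 ?exprn_gt0 ?ltr0n ?fact_gt0.
have b0 : 0 < b by rewrite mulr_gt0 ?exprn_gt0 ?ltr0n ?fact_gt0.
pose K : R := 3 / 4 / 3 ^+ k * 2^-1 ^+ i.
have K0 : 0 < K by rewrite !(mulr_gt0, invr_gt0, exprn_gt0).
exists (K / (Num.sqrt a * b)); first by rewrite divr_gt0 // mulr_gt0 ?sqrtr_gt0.
move=> n w u kn.
have -> : Eperm k w u = n`!%:R^-1 *
    \sum_(s : 'S_n) `|hip k [set: 'I_n] (wcomp s w) u|.
  congr (_ * _); rewrite [RHS](reindex_inj invg_inj) /=.
  by apply: eq_bigr => s _.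
have fn0 : 0 < n`!%:R :> R by rewrite ltr0n fact_gt0.
rewrite ler_pdivlMl //.
have := sum_hip_ge k i w u ik; rewrite card_ord => /(_ kn).
rewrite card_Sn; apply: le_trans.
set C : R := 'C(n./2, i)%:R; set C' : R := 'C(n - 2 * i, k - i)%:R.
have hC : n%:R ^+ i <= a * C.
  apply: exp_natr_le_bin; first by rewrite geq_half_double -mul2n; lia.
  by have := odd_double_half n; rewrite -mul2n; case: (odd n); lia.
have hC' : n%:R ^+ (k - i) <= b * C' by apply: exp_natr_le_bin; nia.
set r := Num.sqrt n%:R.
have n0 : 0 < n%:R :> R by rewrite ltr0n; lia.
have r0 : 0 < r by rewrite sqrtr_gt0.
have rn : n%:R = r ^+ 2 by rewrite sqr_sqrtr // ltW.
(* This splits the power of [n] to match the two binomials: [r ^+ i] against the root of [C], and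
   [n%:R ^+ (k - i)] against [C']. *)
have nk : n%:R ^+ k * r ^- i = r ^+ i * n%:R ^+ (k - i).
  rewrite -{1}(subnK ik) exprD {2}rn -exprM mul2n -addnn exprD.
  by field; rewrite gt_eqF ?exprn_gt0.
have hr : r ^+ i <= Num.sqrt a * Num.sqrt C.
  rewrite -sqrtrM; last exact: ltW.
  rewrite -(ger0_norm (exprn_ge0 i (ltW r0))) -sqrtr_sqr ler_wsqrtr //.
  by rewrite -exprM mulnC exprM -rn.
have W00 : 0 <= Wc k i [set: 'I_n] w * Wc k i [set: 'I_n] u.
  by rewrite mulr_ge0 ?Wc_ge0.
rewrite nk -[_ * Wc _ _ _ w * _]mulrA !mulrA.
rewrite -[_ * Wc _ _ _ w * _]mulrA -[leRHS]mulrA ler_wpM2r //.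
have key : r ^+ i * n%:R ^+ (k - i) <= Num.sqrt a * Num.sqrt C * (b * C').
  by rewrite ler_pM // exprn_ge0 // ltW.
have sa0 : 0 < Num.sqrt a by rewrite sqrtr_gt0.
rewrite -/K.
apply: (@le_trans _ _ (n`!%:R * (K / (Num.sqrt a * b)) *
    (Num.sqrt a * Num.sqrt C * (b * C')))).
  apply: le_trans (ler_wpM2l _ key); first by rewrite !mulrA.
  by rewrite mulr_ge0 ?ltW // divr_gt0 // mulr_gt0.
by rewrite le_eqVlt; apply/orP; left; apply/eqP; field; rewrite !gt_eqF.
Qed.

Theorem theorem1p4 (R : realType) (k : nat) : (1 <= k)%N ->
  exists c : R, 0 < c /\
    forall (n : nat) (w u : {set 'I_n} -> R), (2 * k < n)%N ->
      @Eperm R n k w u >=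
      c * (n%:R) ^+ k *
        \sum_(i < k.+1) (Num.sqrt (n%:R : R)) ^- i *
           Wc k i [set: 'I_n] w * Wc k i [set: 'I_n] u.
Proof.
move=> k1.
have H (i : 'I_k.+1) : {c : R | 0 < c & forall (n : nat) (w u : {set 'I_n} -> R),
    (2 * k < n)%N -> c * (n%:R ^+ k * Num.sqrt n%:R ^- i *
         Wc k i [set: 'I_n] w * Wc k i [set: 'I_n] u) <= Eperm k w u}.
  by apply: cid2; apply: Eperm_ge; rewrite -ltnS.
pose c i := s2val (H i); have c0 i : 0 < c i := s2valP (H i).
have S0 : 0 < \sum_i (c i)^-1.
  rewrite (bigD1 ord0) //= ltr_pwDl ?invr_gt0 // sumr_ge0 // => i _.
  by rewrite invr_ge0 ltW.
(* If [c i] times the term of index [i] is at most the expectation for every [i], the terms sum to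
   at most [\sum_i (c i)^-1] times the expectation. *)
exists (\sum_i (c i)^-1)^-1; split; first by rewrite invr_gt0.
move=> n w u kn; rewrite -mulrA ler_pdivrMl // mulr_sumr mulr_suml.
apply: ler_sum => i _; rewrite ler_pdivlMl // !mulrA -[leLHS]mulrA.
have := s2valP' (H i) n w u kn; rewrite -/(c i).
by rewrite !mulrA.
Qed.
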